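(* Let $n,m,k$ be integers with $2\le m\le n$ and $2\le k\le 2^{m-1}+1$. Then $$v_2\big(s(2^n,2^m-k)\big)=2^n-2^m-(n-m)\Big(2^m-2\Big\lfloor\frac{k}{2}\Big\rfloor\Big)+m-2-v_2\Big(\Big\lfloor\frac{k}{2}\Big\rfloor\Big)+(n-1)\epsilon_k,$$ where $\epsilon_k=0$ if $k$ is even and $\epsilon_k=1$ if $k$ is odd.
   Context: For nonnegative integers $n$, the Pochhammer symbol is $(x)_n=x(x+1)\cdots(x+n-1)$ (with $(x)_0=1$). The (unsigned) Stirling numbers of the first kind $s(n,k)$ are defined by $(x)_n=\sum_{k=0}^n s(n,k)x^k$, and $s(n,k)=0$ for $k>n$. For a nonzero rational $x=n_1/n_2$, $v_2(x)=v_2(n_1)-v_2(n_2)$, where $v_2$ of a nonzero integer is the exponent of the largest power of $2$ dividing it. $\lfloor y\rfloor$ is the floor of $y$. *)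

(* Defs.v *)
From HB Require Import structures.
From mathcomp Require Import all_boot all_order all_algebra.
Set Implicit Arguments. Unset Strict Implicit. Unset Printing Implicit Defensive.
Import Order.TTheory GRing.Theory Num.Theory.
Local Open Scope ring_scope.

Definition pochhammer (n : nat) : {poly int} :=
  \prod_(i < n) ('X + (i%:Z)%:P).

(* unsigned Stirling numbers of the first kind: (x)_n = sum_k s(n,k) x^k *)
Definition stirling1 (n k : nat) : int := (pochhammer n)`_k.

Definition v2 (z : int) : nat := logn 2 `|z|%N.

(* Main.v *)
Require Import Defs.
From HB Require Import structures.
From mathcomp Require Import all_boot all_order all_algebra.
From mathcomp Require Import zify ring.
Set Implicit Arguments.
Unset Strict Implicit.
Unset Printing Implicit Defensive.
Import Order.TTheory GRing.Theory Num.Theory.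
Local Open Scope ring_scope.

(** Put [q = 2 ^ d] with [d = n - m].  Dividing each factor [q y + i] of
    [(q y)_(2^n)] by its content [gcd(q, i)] leaves a product [W_m(y)], and the
    contents multiply to [2 ^ (2^n - 2^m)], so that it remains to find the
    valuations of the coefficients of [W_m].

    Now fix [q] and let [m] vary.  Every factor of [W_0] other than [y] is [1]
    modulo [2], and [W_{m+1}(y) = W_m(y) W_m(y + 2^m)] is [W_m(y)^2] modulo
    [2^m].  As squaring improves a congruence modulo [2^j], [j >= 1], to one
    modulo [2^(j+1)], [W_m = (y^2 + y)^(2^(m-1))] modulo [2^(m-1)].  The
    coefficient of [y^(2^m - k)] is thus [C(2^(m-1), k)] modulo [2^(m-1)]; the
    valuation [m - 1 - v_2(k)] of this binomial coefficient is small enough to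
    be read off when [k] is even.

    For odd [k], the reflection [i -> 2^n - i] of the nonzero indices shows that
    [V(y) = W_m(y) / y] satisfies [V(-y) = - V(y - 2^m)].  Expanding the right
    side to second order, the coefficients satisfy
    [w_j = 2^(m-1) j w_{j+1}] modulo [2^(2m-1)] for odd [j], which reduces [k]
    to [k - 1]. *)

Lemma big_nat_double (R : Type) (idx : R) (op : Monoid.law idx) (n : nat)
    (F : nat -> R) :
  \big[op/idx]_(0 <= i < n.*2) F i =
  \big[op/idx]_(0 <= i < n) op (F i.*2) (F i.*2.+1).
Proof.
rewrite -muln2 big_nat_mul; apply: eq_bigr => i _.
by rewrite !muln2 doubleS big_ltn // big_nat1.
Qed.

Lemma gcdnMBl (k m n : nat) : (n <= k * m)%N -> gcdn m (k * m - n) = gcdn m n.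
Proof.
move=> le_n; apply/eqP; rewrite eqn_dvd !dvdn_gcd !dvdn_gcdl /=.
rewrite -{1}(dvdn_subr le_n) ?dvdn_gcdr; last by rewrite dvdn_mull ?dvdn_gcdl.
by rewrite dvdn_sub ?dvdn_mull ?dvdn_gcdl ?dvdn_gcdr.
Qed.

Definition eqmod (V : zmodType) (N : nat) (x y : V) : Prop :=
  exists r, x = y + r *+ N.

Lemma eqmod_refl (V : zmodType) (N : nat) (x : V) : eqmod N x x.
Proof. by exists 0; rewrite mul0rn addr0. Qed.

Lemma eqmod_trans (V : zmodType) (N : nat) (x y z : V) :
  eqmod N x y -> eqmod N y z -> eqmod N x z.
Proof. by move=> [r ->] [s ->]; exists (s + r); rewrite mulrnDl addrA. Qed.

Lemma eqmod_dvdn (V : zmodType) (M N : nat) (x y : V) :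
  (M %| N)%N -> eqmod N x y -> eqmod M x y.
Proof. by move=> /dvdnP[k ->] [r ->]; exists (r *+ k); rewrite -mulrnA. Qed.

Lemma eqmod_additive (U V : zmodType) (f : {additive U -> V}) (N : nat)
    (x y : U) :
  eqmod N x y -> eqmod N (f x) (f y).
Proof. by move=> [r ->]; exists (f r); rewrite raddfD raddfMn. Qed.

Lemma eqmodM (R : comNzRingType) (N : nat) (x x' y y' : R) :
  eqmod N x x' -> eqmod N y y' -> eqmod N (x * y) (x' * y').
Proof.
by move=> [r ->] [s ->]; exists (x' * s + r * y' + r * s *+ N); ring.
Qed.

Lemma eqmod_prod1 (R : comNzRingType) (N : nat) (I : Type) (s : seq I)
    (P : pred I) (F : I -> R) :
  (forall i, P i -> eqmod N (F i) 1) -> eqmod N (\prod_(i <- s | P i) F i) 1.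
Proof.
move=> eqF1; apply: (big_ind (fun x => eqmod N x 1)) => // [|x y eqx1 eqy1].
  exact: eqmod_refl.
by rewrite -[X in eqmod _ _ X]mulr1; apply: eqmodM.
Qed.

Lemma eqmod_sqr (R : comNzRingType) (N : nat) (x y : R) :
  ~~ odd N -> eqmod N x y -> eqmod (2 * N) (x ^+ 2) (y ^+ 2).
Proof.
move=> evenN [r ->]; exists (y * r + r ^+ 2 *+ N./2).
rewrite -[in LHS](even_halfK evenN) -[in (2 * N)%N](even_halfK evenN) -muln2.
ring.
Qed.

Lemma comp_polyXaddr_taylor2 (R : comNzRingType) (p c : {poly R}) :
  exists r, p \Po ('X + c) = p + c * p^`() + c ^+ 2 * r.
Proof.
elim/poly_ind: p => [|p a [r IHp]].
  by exists 0; rewrite comp_poly0 deriv0 !mulr0 !addr0.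
exists (r * 'X + p^`() + c * r).
rewrite comp_polyD comp_polyM comp_polyX comp_polyC IHp.
rewrite derivD derivM derivX derivC; ring.
Qed.

Lemma comp_polyXaddn_eqmod (R : comNzRingType) (p : {poly R}) (N : nat) :
  eqmod N (p \Po ('X + N%:R)) p.
Proof.
have [r ->] := comp_polyXaddr_taylor2 p N%:R.
by exists (p^`() + r *+ N); ring.
Qed.

Lemma coef_comp_polyZX (R : comNzRingType) (p : {poly R}) (a : R) (j : nat) :
  (p \Po (a *: 'X))`_j = a ^+ j * p`_j.
Proof.
elim/poly_ind: p j => [|p c IHp] j; first by rewrite comp_poly0 coef0 mulr0.
rewrite comp_polyD comp_polyM comp_polyX comp_polyC -scalerAr.
rewrite !(coefD, coefZ, coefMX, coefC).
case: j => [|j] /=; first by rewrite mulr0 expr0 mul1r.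
by rewrite IHp !addr0 exprS mulrA.
Qed.

Lemma coef_XsqrDX_exp (R : comNzRingType) (n i : nat) :
  (('X ^+ 2 + 'X : {poly R}) ^+ n)`_(n + i) = 'C(n, i)%:R.
Proof.
have -> : 'X ^+ 2 + 'X = 'X * ('X + 1) :> {poly R} by ring.
rewrite exprMn coefXnM ltnNge leq_addr addKn exprD1n.
under eq_bigr do rewrite -scaler_nat.
rewrite -(poly_def n.+1 (fun i => 'C(n, i)%:R)) coef_poly ltnS.
by case: leqP => // lt_n_i; rewrite bin_small.
Qed.

Lemma reflected_coef_eqmod (p : {poly int}) (b j : nat) : ~~ odd j ->
  p \Po - 'X = - (p \Po ('X - (2 * b)%:R)) ->
  eqmod (2 * b ^ 2) p`_j (p`_j.+1 *+ (b * j.+1)).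
Proof.
move=> even_j.
have [r ->] := comp_polyXaddr_taylor2 p (- (2 * b)%:R) => reflect_p.
exists (- r`_j); apply: (@mulfI _ 2%:R) => //.
have := congr1 (fun q : {poly int} => q`_j) reflect_p.
rewrite -scaleN1r coef_comp_polyZX -signr_odd (negbTE even_j) expr0 mul1r.
rewrite coefN !coefD sqrrN -natrX mulNr coefN !mulr_natl !coefMn coef_deriv.
by move=> coef_eq; rewrite [LHS]mulr2n {2}coef_eq; ring.
Qed.

Lemma logn2_double (n : nat) : (0 < n)%N -> logn 2 n.*2 = (logn 2 n).+1.
Proof. by move=> n_gt0; rewrite -mul2n lognM // (@pfactorK 2 1). Qed.

Lemma leq_logn_pexp (p M k : nat) :
  prime p -> (0 < k <= p ^ M)%N -> (logn p k <= M)%N.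
Proof.
move=> p_prime /andP[k_gt0 le_k]; rewrite -(leq_exp2l _ _ (prime_gt1 p_prime)).
by rewrite (leq_trans _ le_k) // dvdn_leq // pfactor_dvdnn.
Qed.

Lemma ltn_logn_pexp (p M k : nat) :
  prime p -> (0 < k < p ^ M)%N -> (logn p k < M)%N.
Proof.
move=> p_prime /andP[k_gt0 lt_k]; rewrite -(ltn_exp2l _ _ (prime_gt1 p_prime)).
by rewrite (leq_ltn_trans _ lt_k) // dvdn_leq // pfactor_dvdnn.
Qed.

Lemma logn_bin_pexp_diag (p M j : nat) : prime p -> (j < p ^ M)%N ->
  (M + logn p 'C((p ^ M).-1, j) = logn p j.+1 + logn p 'C(p ^ M, j.+1))%N.
Proof.
move=> p_prime lt_j; rewrite -lognM ?bin_gt0 // -mul_bin_diag.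
by rewrite lognM ?bin_gt0 ?pfactorK //; lia.
Qed.

Lemma prime_ndvd_bin_pexp_pred (p M j : nat) :
  prime p -> (j < p ^ M)%N -> ~~ (p %| 'C((p ^ M).-1, j))%N.
Proof.
move=> p_prime; elim: j => [|j IHj] lt_j.
  by rewrite bin0 dvdn1 neq_ltn prime_gt1 ?orbT.
have dvd_bin : (p %| 'C(p ^ M, j.+1))%N.
  have lt_logn := @ltn_logn_pexp p M j.+1 p_prime lt_j.
  have bin_pos : (0 < 'C(p ^ M, j.+1))%N by rewrite bin_gt0 ltnW.
  have := logn_bin_pexp_diag p_prime (ltnW lt_j).
  by rewrite -[p in (p %| _)%N]expn1 pfactor_dvdn //; lia.
move: dvd_bin; rewrite -[in 'C(p ^ M, _)](ltn_predK lt_j) binS => dvd_sum.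
by apply: contra (IHj (ltnW lt_j)) => dvd_bin; rewrite -(dvdn_addr _ dvd_bin).
Qed.

Lemma logn_bin_pexp (p M k : nat) : prime p -> (0 < k <= p ^ M)%N ->
  logn p 'C(p ^ M, k) = (M - logn p k)%N.
Proof.
case: k => // j p_prime /andP[_ lt_j].
have := logn_bin_pexp_diag p_prime lt_j.
have := prime_ndvd_bin_pexp_pred p_prime lt_j.
rewrite -prime_coprime // => /logn_coprime->; lia.
Qed.

(* [v2 0 = 0], hence the explicit nonvanishing. *)
Definition has_v2 (e : nat) (a : int) : bool := (a != 0) && (v2 a == e).

Lemma has_v2E (e : nat) (a : int) :
  has_v2 e a = (2 ^+ e %| a)%Z && ~~ (2 ^+ e.+1 %| a)%Z.
Proof.
have [->|a_neq0] := eqVneq a 0; first by rewrite /has_v2 eqxx !dvdz0.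
rewrite /has_v2 a_neq0 !dvdzE !abszX !pfactor_dvdn ?absz_gt0 //.
by rewrite -leqNgt eqn_leq [RHS]andbC.
Qed.

Lemma has_v2_eqmod (e f : nat) (a b : int) : (e < f)%N ->
  eqmod (2 ^ f) a b -> has_v2 e b -> has_v2 e a.
Proof.
move=> lt_ef [r ->].
have dvdE i : (i <= f)%N -> (2 ^+ i %| b + r *+ 2 ^ f)%Z = (2 ^+ i %| b)%Z.
  move=> le_if; rewrite rpredDr // -[r *+ _]mulr_natr natrX -(subnKC le_if).
  by rewrite exprD dvdz_mull // dvdz_mulr.
by rewrite !has_v2E !dvdE // ltnW.
Qed.

Lemma has_v2M (e f : nat) (a b : int) :
  has_v2 e a -> has_v2 f b -> has_v2 (e + f) (a * b).
Proof.
move=> /andP[a_neq0 /eqP<-] /andP[b_neq0 /eqP<-].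
by rewrite /has_v2 mulf_neq0 //= /v2 abszM lognM ?absz_gt0.
Qed.

Lemma has_v2_nat (n : nat) : (0 < n)%N -> has_v2 (logn 2 n) n%:R.
Proof.
by move=> n_gt0; rewrite /has_v2 pnatr_eq0 -lt0n n_gt0 /v2 natz absz_nat /=.
Qed.

Lemma has_v2_pow2 (i : nat) : has_v2 i (2 ^ i)%:R.
Proof. by rewrite -{1}(pfactorK i (isT : prime 2)) has_v2_nat ?expn_gt0. Qed.

Lemma has_v2_odd (n : nat) : odd n -> has_v2 0 n%:R.
Proof.
move=> odd_n; have := has_v2_nat (odd_gt0 odd_n).
by rewrite logn_coprime // coprime2n.
Qed.

Section ReducedPochhammer.
Variable q : nat.

(* ['X *+ q + i] divided by its content. *)
Definition reduced_factor (i : nat) : {poly int} :=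
  'X *+ (q %/ gcdn q i) + (i %/ gcdn q i)%:R.

Definition reduced_pochhammer (N : nat) : {poly int} :=
  \prod_(0 <= i < N) reduced_factor i.

Lemma comp_reduced_factor (i : nat) (p : {poly int}) :
  reduced_factor i \Po p = p *+ (q %/ gcdn q i) + (i %/ gcdn q i)%:R.
Proof. by rewrite comp_polyD raddfMn /= comp_polyX rmorph_nat. Qed.

Lemma pochhammer_comp_polyXMn (N : nat) :
  pochhammer N \Po ('X *+ q) =
  reduced_pochhammer N *+ \prod_(0 <= i < N) gcdn q i.
Proof.
rewrite /pochhammer /reduced_pochhammer -prodrMn rmorph_prod big_mkord /=.
apply: eq_bigr => i _; rewrite comp_polyD comp_polyX comp_polyC mulrnDl.
by rewrite -!mulrnA !divnK ?dvdn_gcdl ?dvdn_gcdr // -natz rmorph_nat.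
Qed.

Hypothesis q_gt0 : (0 < q)%N.

Lemma reduced_factor0 : reduced_factor 0 = 'X.
Proof. by rewrite /reduced_factor gcdn0 divnn q_gt0 div0n addr0. Qed.

Lemma reduced_factor_addM (M i : nat) :
  reduced_factor (M * q + i) = reduced_factor i \Po ('X + M%:R).
Proof.
rewrite comp_reduced_factor /reduced_factor gcdnMDl.
by rewrite divnDl ?dvdn_mull ?dvdn_gcdl // -muln_divA ?dvdn_gcdl //; ring.
Qed.

Lemma reduced_factor_subM (M i : nat) : (i <= M * q)%N ->
  reduced_factor (M * q - i) \Po ('X - M%:R) = - (reduced_factor i \Po - 'X).
Proof.
move=> le_i; rewrite !comp_reduced_factor gcdnMBl // divnBr ?dvdn_gcdr //.
rewrite natrB ?leq_div2r // -muln_divA ?dvdn_gcdl //; ring.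
Qed.

Lemma reduced_pochhammerD (M N : nat) :
  reduced_pochhammer (M * q + N) =
  reduced_pochhammer (M * q) * (reduced_pochhammer N \Po ('X + M%:R)).
Proof.
rewrite /reduced_pochhammer (@big_cat_nat _ _ _ (M * q)) ?leq_addr //=.
rewrite -{2}[(M * q)%N]add0n big_addn addKn rmorph_prod; congr (_ * _).
by apply: eq_bigr => i _; rewrite addnC reduced_factor_addM.
Qed.

Definition reduced_pochhammer_tail (N : nat) : {poly int} :=
  \prod_(1 <= i < N) reduced_factor i.

Lemma reduced_pochhammer_tailE (N : nat) : (0 < N)%N ->
  reduced_pochhammer N = 'X * reduced_pochhammer_tail N.
Proof.
by move=> N_gt0; rewrite /reduced_pochhammer big_ltn // reduced_factor0.
Qed.

Lemma reduced_pochhammer_tail_reflect (M : nat) : (0 < M)%N -> ~~ odd (M * q) ->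
  reduced_pochhammer_tail (M * q) \Po - 'X =
  - (reduced_pochhammer_tail (M * q) \Po ('X - M%:R)).
Proof.
move=> M_gt0 even_Mq.
have Mq_gt0 : (0 < M * q)%N by rewrite muln_gt0 M_gt0.
rewrite /reduced_pochhammer_tail [in RHS]big_nat_rev !rmorph_prod /=.
transitivity (- \prod_(1 <= i < M * q) (-1 * (reduced_factor i \Po - 'X))).
  rewrite big_split prodr_const_nat /= -signr_odd oddB // (negbTE even_Mq).
  by rewrite expr1 mulN1r opprK.
congr (- _); rewrite big_seq [RHS]big_seq; apply: eq_bigr => i.
rewrite mem_index_iota => /andP[_ lt_i].
by rewrite add1n subSS mulN1r -(@reduced_factor_subM M) // ltnW.
Qed.

End ReducedPochhammer.

Lemma prod_gcdn_pow2 (d M : nat) :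
  (\prod_(0 <= i < M * 2 ^ d) gcdn (2 ^ d) i = 2 ^ (M * (2 ^ d).-1))%N.
Proof.
elim: d M => [|d IHd] M.
  by rewrite big1 ?muln0 // => i _; rewrite expn0 gcd1n.
have gcdn_even i : gcdn (2 ^ d.+1) i.*2 = (2 * gcdn (2 ^ d) i)%N.
  by rewrite expnS -mul2n -muln_gcdr.
have gcdn_odd i : gcdn (2 ^ d.+1) i.*2.+1 = 1%N.
  by apply/eqP/coprimeXl; rewrite coprime2n /= odd_double.
have -> : (M * 2 ^ d.+1 = (M * 2 ^ d).*2)%N by rewrite expnS mulnCA mul2n.
rewrite big_nat_double /=.
under eq_bigr do rewrite gcdn_even gcdn_odd muln1.
rewrite big_split /= prod_nat_const_nat subn0 IHd -expnD -mulnDr.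
congr (_ ^ (_ * _))%N; have := expn_gt0 2 d; rewrite expnS; lia.
Qed.

Definition dyadic_pochhammer (d m : nat) : {poly int} :=
  reduced_pochhammer (2 ^ d) (2 ^ m * 2 ^ d).

Lemma dyadic_pochhammerS (d m : nat) :
  dyadic_pochhammer d m.+1 =
  dyadic_pochhammer d m * (dyadic_pochhammer d m \Po ('X + (2 ^ m)%:R)).
Proof.
rewrite /dyadic_pochhammer expnS mul2n -addnn mulnDl.
by rewrite reduced_pochhammerD ?expn_gt0.
Qed.

Lemma reduced_factor_pow2_eqmod2 (d i : nat) :
  (0 < i < 2 ^ d)%N -> eqmod 2 (reduced_factor (2 ^ d) i) 1.
Proof.
case/andP=> i_gt0 lt_i; rewrite /reduced_factor; set g := gcdn (2 ^ d) i.
have [e le_ed gE] : exists2 e, (e <= d)%N & g = (2 ^ e)%N.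
  by apply/dvdn_pfactor; rewrite // dvdn_gcdl.
have lt_ed : (e < d)%N.
  rewrite -(ltn_exp2l _ _ (ltnSn 1)) -gE (leq_ltn_trans _ lt_i) //.
  by rewrite dvdn_leq ?dvdn_gcdr.
have even_quot : ~~ odd (2 ^ d %/ g) by rewrite gE -expnB // oddX; lia.
have odd_quot : odd (i %/ g).
  rewrite -[odd _]negbK -dvdn2 -(@dvdn_pmul2r g) ?gE ?expn_gt0 // -gE.
  rewrite divnK ?dvdn_gcdr //; apply/negP => dvd_2g_i.
  have : (2 * g %| g)%N by rewrite {2}/g dvdn_gcd dvd_2g_i gE -expnS dvdn_exp2l.
  by move/dvdn_leq; rewrite gE; have := expn_gt0 2 e; lia.
exists ('X *+ (2 ^ d %/ g)./2 + ((i %/ g)./2)%:R).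
rewrite -{1}(odd_double_half (2 ^ d %/ g)) -{1}(odd_double_half (i %/ g)).
by rewrite (negbTE even_quot) odd_quot -!muln2 /=; ring.
Qed.

Lemma dyadic_pochhammer0_eqmod2 (d : nat) : eqmod 2 (dyadic_pochhammer d 0) 'X.
Proof.
rewrite /dyadic_pochhammer mul1n reduced_pochhammer_tailE ?expn_gt0 //.
rewrite -[X in eqmod _ _ X]mulr1; apply: eqmodM; first exact: eqmod_refl.
rewrite /reduced_pochhammer_tail big_seq.
apply: eqmod_prod1 => i; rewrite mem_index_iota.
exact: reduced_factor_pow2_eqmod2.
Qed.

Lemma dyadic_pochhammer_eqmod (d m : nat) :
  eqmod (2 ^ maxn m 1) (dyadic_pochhammer d m.+1) (('X ^+ 2 + 'X) ^+ (2 ^ m)).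
Proof.
elim: m => [|m IHm].
  rewrite dyadic_pochhammerS expr1 (_ : _ + 'X = 'X * ('X \Po ('X + 1%:R))).
    apply: eqmodM; first exact: dyadic_pochhammer0_eqmod2.
    exact/eqmod_additive/dyadic_pochhammer0_eqmod2.
  by rewrite comp_polyX; ring.
rewrite (maxn_idPl (ltn0Sn m)) dyadic_pochhammerS expnSr exprM.
apply: (@eqmod_trans _ _ _ (dyadic_pochhammer d m.+1 ^+ 2)).
  rewrite expr2; apply: eqmodM; first exact: eqmod_refl.
  exact: comp_polyXaddn_eqmod.
apply: (@eqmod_dvdn _ _ (2 * 2 ^ maxn m 1)%N).
  by rewrite -expnS -expnSr dvdn_exp2l // ltnS leq_maxl.
by apply: eqmod_sqr => //; rewrite oddX /= orbF; lia.
Qed.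

Lemma coef_dyadic_eqmod (d m k : nat) : (k <= 2 ^ m)%N ->
  eqmod (2 ^ m) (dyadic_pochhammer d m.+1)`_(2 ^ m.+1 - k) 'C(2 ^ m, k)%:R.
Proof.
move=> le_k; rewrite -(bin_sub le_k) -(coef_XsqrDX_exp int) addnBA //.
rewrite addnn -mul2n -expnS; apply: (eqmod_additive (coefp _)).
apply: eqmod_dvdn (dyadic_pochhammer_eqmod d m).
by rewrite dvdn_exp2l ?leq_maxl.
Qed.

Lemma has_v2_coef_dyadic_even (d m k : nat) : ~~ odd k -> (0 < k <= 2 ^ m)%N ->
  has_v2 (m - logn 2 k) (dyadic_pochhammer d m.+1)`_(2 ^ m.+1 - k).
Proof.
move=> even_k /[dup] bound_k /andP[k_gt0 le_k].
have logn_k_gt0 : (0 < logn 2 k)%N.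
  by rewrite logn_gt0 mem_primes k_gt0 dvdn2 even_k.
have le_logn_k : (logn 2 k <= m)%N by exact: leq_logn_pexp bound_k.
apply: has_v2_eqmod (coef_dyadic_eqmod d le_k) _; first by lia.
by rewrite -(logn_bin_pexp _ bound_k) // has_v2_nat ?bin_gt0.
Qed.

Lemma coef_dyadic_odd_eqmod (d m j : nat) : odd j ->
  eqmod (2 ^ m.*2.+1) (dyadic_pochhammer d m.+1)`_j
        ((dyadic_pochhammer d m.+1)`_j.+1 *+ (2 ^ m * j)).
Proof.
case: j => // j; rewrite /= => even_j.
have even_N : ~~ odd (2 ^ m.+1 * 2 ^ d) by rewrite -expnD oddX.
rewrite expnS -muln2 expnM /dyadic_pochhammer.
rewrite reduced_pochhammer_tailE ?muln_gt0 ?expn_gt0 // !coefXM.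
apply: reflected_coef_eqmod even_j _; rewrite -expnS.
by apply: reduced_pochhammer_tail_reflect; rewrite ?expn_gt0.
Qed.

Lemma has_v2_coef_dyadic_odd (d m k : nat) : ~~ odd k -> (0 < k <= 2 ^ m)%N ->
  has_v2 (m + (m - logn 2 k)) (dyadic_pochhammer d m.+1)`_(2 ^ m.+1 - k.+1).
Proof.
move=> even_k /[dup] bound_k /andP[k_gt0 le_k].
have lt_k : (k < 2 ^ m.+1)%N by rewrite expnS; lia.
have odd_j : odd (2 ^ m.+1 - k.+1) by rewrite oddB //= oddX even_k.
apply: has_v2_eqmod (coef_dyadic_odd_eqmod _ _ odd_j) _; first by lia.
rewrite -subSn // subSS mulrnA -mulr_natr -[X in X * _]mulr_natr.
have v2_coef := has_v2_coef_dyadic_even d even_k bound_k.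
have := has_v2M (has_v2M v2_coef (has_v2_pow2 m)) (has_v2_odd odd_j).
by rewrite addn0 addnC.
Qed.

Lemma has_v2_coef_dyadic (d m h : nat) (b : bool) : (0 < h.*2 <= 2 ^ m)%N ->
  has_v2 (b * m + (m - (logn 2 h).+1))
         (dyadic_pochhammer d m.+1)`_(2 ^ m.+1 - (b + h.*2)).
Proof.
move=> /[dup] bound_h /andP[]; rewrite double_gt0 => h_gt0 _.
rewrite -logn2_double //; case: b.
  by rewrite mul1n add1n has_v2_coef_dyadic_odd ?odd_double.
by rewrite mul0n !add0n has_v2_coef_dyadic_even ?odd_double.
Qed.

Lemma pochhammer_pow2_comp_polyXMn (d m : nat) :
  pochhammer (2 ^ (d + m)) \Po ('X *+ 2 ^ d) =
  dyadic_pochhammer d m *+ 2 ^ (2 ^ m * (2 ^ d).-1).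
Proof. by rewrite addnC expnD pochhammer_comp_polyXMn prod_gcdn_pow2. Qed.

Lemma v2_stirling1_pow2 (d m j e : nat) : has_v2 e (dyadic_pochhammer d m)`_j ->
  (v2 (stirling1 (2 ^ (d + m)) j))%:Z =
  (2 ^ (d + m))%:Z - (2 ^ m)%:Z - d%:Z * j%:Z + e%:Z :> int.
Proof.
move/has_v2M/(_ (has_v2_pow2 (2 ^ m * (2 ^ d).-1)%N)).
rewrite mulr_natr -coefMn -pochhammer_pow2_comp_polyXMn -scaler_nat.
rewrite coef_comp_polyZX -natrX -expnM -/(stirling1 _ _).
set s := stirling1 _ _ => /andP[+ /eqP v2_prod].
rewrite mulf_eq0 negb_or => /andP[_ s_neq0].
have v2_s : has_v2 (v2 s) s by rewrite /has_v2 s_neq0 eqxx.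
have /andP[_ /eqP v2_eq] := has_v2M (has_v2_pow2 (d * j)) v2_s.
have expn_eq : (2 ^ m * (2 ^ d).-1 + 2 ^ m = 2 ^ (d + m))%N.
  by rewrite -mulnSr prednK ?expn_gt0 // addnC expnD.
rewrite v2_eq in v2_prod.
by move: (2 ^ m * _)%N expn_eq v2_prod => B expn_eq v2_prod; lia.
Qed.

Theorem theorem1p1 (n m k : nat) :
  (2 <= m)%N -> (m <= n)%N -> (2 <= k)%N -> (k <= 2 ^ m.-1 + 1)%N ->
  ((v2 (stirling1 (2 ^ n) (2 ^ m - k)))%:Z : int) =
    (2 ^ n)%:Z - (2 ^ m)%:Z
    - ((n - m)%:Z) * ((2 ^ m)%:Z - 2 * (k./2)%:Z)
    + m%:Z - 2 - (v2 (k./2)%:Z)%:Z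
    + (n.-1)%:Z * (odd k)%:Z.
Proof.
case: m => [//|m] m_gt0 /subnK <- k_ge2; rewrite addnK -pred_Sn => le_k.
set d := (n - _)%N; rewrite -[in stirling1 _ _](odd_double_half k).
set h := k./2.
have bound_h : (0 < h.*2 <= 2 ^ m)%N.
  by case: m m_gt0 le_k {d} => // m _; rewrite expnS; lia.
have le_sum : (odd k + h.*2 <= 2 ^ m.+1)%N by rewrite expnS; lia.
have lt_logn_h : (logn 2 h < m)%N.
  by rewrite -logn2_double; [exact: leq_logn_pexp bound_h | lia].
rewrite (v2_stirling1_pow2 (has_v2_coef_dyadic d (odd k) bound_h)).
rewrite -subzn // /v2 absz_nat; case: (odd k); lia.
Qed.
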